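(* Let $n\geq 0$. The transfinite sequence $\{ho(\mathbf{w}_n^{\kappa}(X))\}_{\kappa}$ of homotopy types is a homotopy invariant of $X$. That is, if $X$ and $Y$ are homotopy equivalent spaces, then $ho(\mathbf{w}_n^{\kappa}(X))=ho(\mathbf{w}_n^{\kappa}(Y))$ for every ordinal $\kappa$.
   Context: All topological spaces are Hausdorff and ''map'' means continuous function. $ho(X)$ denotes the homotopy type of $X$. $S^n$ is the unit $n$-sphere with basepoint $s_0=(1,0,\dots,0)$. A map $f:S^n\to X$ is essential if it is not null-homotopic. A sequence of maps $f_k:S^n\to X$, $k\in\mathbb{N}$, converges to $x\in X$ if for every neighborhood $U$ of $x$ there is $K$ with $\mathrm{Im}(f_k)\subseteq U$ for all $k\geq K$. The $\pi_n$-wild set $\mathbf{w}_n(X)$ is the subspace of all points $x\in X$ for which there is a sequence of essential based maps $f_k:(S^n,s_0)\to (X,x)$ converging to $x$. Iterated wild sets: $\mathbf{w}_n^0(X)=X$, $\mathbf{w}_n^{\kappa+1}(X)=\mathbf{w}_n(\mathbf{w}_n^{\kappa}(X))$ (with the subspace topology on $\mathbf{w}_n^{\kappa}(X)$), and $\mathbf{w}_n^{\kappa}(X)=\bigcap_{\mu<\kappa}\mathbf{w}_n^{\mu}(X)$ for limit ordinals $\kappa$. *)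

(* Defs.v *)
From HB Require Import structures.
From mathcomp Require Import all_boot all_order all_algebra.
From mathcomp Require Import all_classical all_reals all_analysis.
From mathcomp Require Import wochoice.

Set Implicit Arguments.
Unset Strict Implicit.
Unset Printing Implicit Defensive.

Import Order.TTheory GRing.Theory Num.Theory.
Import numFieldNormedType.Exports.

Local Open Scope classical_set_scope.
Local Open Scope ring_scope.

(** Homotopy. Only the values of [H] over [0, 1] matter. *)

Definition homotopic (R : realType) (X Y : topologicalType) (f g : X -> Y) :=
  exists H : X * R -> Y,
    [/\ {within [set: X] `*` `[0, 1]%classic, continuous H},
        forall x, H (x, 0) = f x
      & forall x, H (x, 1) = g x].

Definition homotopy_equivalent (R : realType) (X Y : topologicalType) :=
  exists (f : X -> Y) (g : Y -> X),
    [/\ continuous f, continuous g,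
        homotopic R (g \o f) id & homotopic R (f \o g) id].

(* The homotopy type as an equivalence class of spaces. *)
Definition ho (R : realType) (X : topologicalType) : topologicalType -> Prop :=
  fun Z => homotopy_equivalent R X Z.

Definition null_homotopic (R : realType) (X Y : topologicalType) (f : X -> Y) :=
  exists c : Y, homotopic R f (fun=> c).

(** Spheres: coerced to a type, [sphere R n] has the topology induced by
    R^(n+1). *)

Definition sphere (R : realType) (n : nat) : set 'rV[R]_n.+1 :=
  [set x | \sum_(i < n.+1) x ord0 i ^+ 2 = 1].
Arguments sphere : clear implicits.

Lemma sphere_base_subproof (R : realType) (n : nat) :
  (delta_mx ord0 ord0 : 'rV[R]_n.+1) \in sphere R n.
Proof.
rewrite inE /sphere /= (bigD1 ord0) //= mxE !eqxx expr1n big1 ?addr0 // => i i0.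
by rewrite mxE eqxx (negbTE i0) expr0n.
Qed.

Definition sphere_base (R : realType) (n : nat) : sphere R n :=
  Sub (delta_mx ord0 ord0) (sphere_base_subproof R n).

Definition essential (R : realType) (n : nat) (X : topologicalType)
    (f : sphere R n -> X) :=
  continuous f /\ ~ null_homotopic R f.

Definition maps_converge_to (R : realType) (n : nat) (X : topologicalType)
    (f : nat -> sphere R n -> X) (x : X) :=
  forall U, nbhs x U ->
    exists K : nat, forall k, (K <= k)%N -> range (f k) `<=` U.

Definition wild (R : realType) (n : nat) (X : topologicalType) : set X :=
  [set x | exists f : nat -> sphere R n -> X,
     [/\ forall k, essential (f k),
         forall k, f k (sphere_base R n) = x
       & maps_converge_to f x]].
Arguments wild : clear implicits.

(* The wild set of the subspace [A] of [X], regarded as a subset of [X]; the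
   maps take values in [A] and must be essential in [A]. *)
Definition wild_sub (R : realType) (n : nat) (X : topologicalType)
    (A : set X) : set X :=
  set_val @` wild R n A.

(** Ordinals are represented by the elements [k] of a well-ordered type [W],
    [k] standing for the order type of its initial segment; every ordinal
    arises in this way. *)

Definition is_successor (d : Order.disp_t) (W : orderType d) (j k : W) :=
  (j < k)%O /\ forall i : W, (i < k)%O -> (i <= j)%O.

Lemma well_order_wf (d : Order.disp_t) (W : orderType d) :
  well_order (<=%O : rel W) -> well_founded (fun i j : W => (i < j)%O).
Proof.
move=> wo x; have [//|nAx] := pselect (Acc (fun i j : W => (i < j)%O) x).
have [|z [[]]] := wo [pred y | `[< ~ Acc (fun i j : W => (i < j)%O) y >]].
  by exists x; apply/asboolP.
move=> /asboolP nAz zmin _; case: nAz; constructor=> y yz.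
have [//|/asboolP/zmin] := pselect (Acc (fun i j : W => (i < j)%O) y).
by rewrite leNgt yz.
Qed.

Section IteratedWild.
Variables (R : realType) (n : nat) (X : topologicalType).
Variables (d : Order.disp_t) (W : orderType d).
Hypothesis wo : well_order (<=%O : rel W).

(* For [k] the least element the second disjunct holds vacuously, giving all
   of [X]. *)
Definition iterated_wild_step (k : W)
    (rec : forall j : W, (j < k)%O -> set X) : set X :=
  [set x | (exists (j : W) (jk : (j < k)%O),
               is_successor j k /\ wild_sub R n (rec j jk) x)
        \/ ((~ exists j, is_successor j k) /\
            forall (j : W) (jk : (j < k)%O), rec j jk x)].

Definition iterated_wild : W -> set X :=
  Fix (well_order_wf wo) (fun=> set X) iterated_wild_step.

Lemma iterated_wildE k :
  iterated_wild k = iterated_wild_step (fun j (_ : (j < k)%O) => iterated_wild j).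
Proof.
apply: (Fix_eq (well_order_wf wo) (fun=> set X)) => {}k f g fg.
by congr iterated_wild_step; do 2 apply: functional_extensionality_dep => ?.
Qed.

Lemma iterated_wild0 k : (forall j, (k <= j)%O) -> iterated_wild k = [set: X].
Proof.
move=> kmin; rewrite iterated_wildE; apply/seteqP; split=> // x _; right.
by split=> [[j []]|j]; rewrite ltNge kmin.
Qed.

Lemma iterated_wildS j k : is_successor j k ->
  iterated_wild k = wild_sub R n (iterated_wild j).
Proof.
move=> sjk; rewrite iterated_wildE; apply/seteqP; split=> x.
  case=> [[i [ik [[_ si] wx]]]|[]]; last by case; exists j.
  suff -> : j = i by [].
  by case: sjk => jk sj; apply/le_anti; rewrite si ?sj.
by move=> wx; left; exists j, sjk.1.
Qed.

Lemma iterated_wild_lim k : (exists j, (j < k)%O) ->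
  (~ exists j, is_successor j k) ->
  iterated_wild k = \bigcap_(j in [set j | (j < k)%O]) iterated_wild j.
Proof.
move=> _ nsk; rewrite iterated_wildE; apply/seteqP; split=> x.
  by case=> [[j [_ [sj _]]]|[_ +]] //; case: nsk; exists j.
by move=> h; right; split.
Qed.

End IteratedWild.
Arguments iterated_wild R n X {d W} wo k.

(* Main.v *)
Require Import Defs.
From mathcomp Require Import all_boot all_order all_algebra.
From mathcomp Require Import all_classical all_reals all_analysis.
From mathcomp Require Import wochoice ring lra.

(** Let [f : X -> Y] and [g : Y -> X] be inverse homotopy equivalences, with
    homotopies [H] from [g \o f] to the identity of [X] and [K] from [f \o g]
    to the identity of [Y].  These same four maps restrict to every stage of the
    two sequences of wild sets, hence exhibit corresponding stages as homotopy
    equivalent.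

    The reason is that [f] carries wild points to wild points
    ([wild_homo]): if essential maps [u k] converge to [x], then the maps
    [f \o u k] converge to [f x] by continuity, and they are essential because
    a null-homotopy of [f \o u k] yields one of [g \o f \o u k], which is
    homotopic to [u k].  This uses only that [f] has a left homotopy inverse, so
    it applies to each map [H (-, t)] as well: the remaining part of [H] is a
    homotopy from it to the identity ([wild_sub_homo_track]).  Hence each
    [H (-, t)] also preserves the wild set, which is exactly what is needed for
    [H] to restrict to a homotopy on the wild set.

    The statement that [f], [g], [H] and [K] restrict to subsets [A] and [B]
    ([restricts]) is therefore inherited by the wild sets of [A] and [B]; it is
    inherited by intersections trivially, so well-founded induction reaches all
    stages ([restricts_iterated_wild]). *)

Set Implicit Arguments.
Unset Strict Implicit.
Unset Printing Implicit Defensive.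

Import Order.TTheory GRing.Theory Num.Theory.
Import numFieldNormedType.Exports.

Local Open Scope classical_set_scope.
Local Open Scope ring_scope.

(** * Subspaces *)

Definition corestrict (T U : Type) (B : set U) (f : T -> U)
    (fB : forall x, B (f x)) (x : T) : B :=
  SigSub (mem_set (fB x)).

Lemma corestrict_continuous (T U : topologicalType) (B : set U) (f : T -> U)
    (fB : forall x, B (f x)) :
  continuous f -> continuous (corestrict fB).
Proof. by move=> cf; apply: continuous_comp_initial; exact: cf. Qed.

Lemma set_val_continuous (U : topologicalType) (B : set U) :
  continuous (set_val : B -> U).
Proof. exact: initial_continuous. Qed.

Lemma pair_continuous (T U V : topologicalType) (f : T -> U) (g : T -> V) :
  continuous f -> continuous g -> continuous (fun x => (f x, g x)).
Proof. by move=> cf cg x; apply: cvg_pair; [exact: cf|exact: cg]. Qed.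

(** * Homotopies *)

(** The time parameter ranges over the whole line and [H] is continuous
    everywhere.  If every [H (-, t)] preserves a subspace [A], restricting [H]
    then gives a total map [A * R -> A], and time can be reparametrised affinely without checking that
    it stays in the unit interval. *)
Definition full_homotopy (R : realType) (X Y : topologicalType)
    (H : X * R -> Y) (f g : X -> Y) :=
  [/\ continuous H, forall x, H (x, 0) = f x & forall x, H (x, 1) = g x].

(** A homotopy on the unit interval extends to the line by clamping the time:
    the points before 0 and after 1 are sent to the end stages. *)
Lemma homotopicP (R : realType) (X Y : topologicalType) (f g : X -> Y) :
  homotopic R f g <-> exists H, full_homotopy (R := R) H f g.
Proof.
split=> [[H [cH H0 H1]]|[H [cH H0 H1]]]; last first.
  by exists H; split=> //; exact: continuous_subspaceT.
pose c (t : R) : R := Num.max 0 (Num.min t 1).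
have cc : continuous c.
  move=> t; apply: (@continuous_max R R (fun=> 0) (fun s => Num.min s 1)).
    exact: cvg_cst.
  apply: (@continuous_min R R id (fun=> 1)); [exact: cvg_id|exact: cvg_cst].
have c01 (z : X * R) : ([set: X] `*` `[0, 1]%classic) (z.1, c z.2).
  split=> //=; rewrite in_itv /= le_max lexx /= ge_max ler01 /=.
  by rewrite ge_min lexx orbT.
exists (fun z => H (z.1, c z.2)); split=> [|x|x] /=.
- have -> : (fun z => H (z.1, c z.2)) =
      sigL ([set: X] `*` `[0, 1]%classic) H \o corestrict c01 by [].
  move=> z; apply: continuous_comp; last first.
    by move/subspace_sigL_continuousP: cH; exact.
  apply: corestrict_continuous.
  apply: (@pair_continuous _ _ _ fst (c \o snd)) => {}z; first exact: cvg_fst.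
  by apply: continuous_comp; [exact: cvg_snd|exact: cc].
- by rewrite /c min_l ?ler01// maxxx H0.
- by rewrite /c minxx max_r ?ler01// H1.
Qed.

Lemma affine_time_continuous (R : realType) (X : topologicalType) (a b : R) :
  continuous (fun z : X * R => (z.1, a * z.2 + b)).
Proof.
apply: (@pair_continuous _ _ _ fst (fun z : X * R => a * z.2 + b)) => z;
  first exact: cvg_fst.
by apply: cvgD; [apply: cvgM; [exact: cvg_cst|exact: cvg_snd]|exact: cvg_cst].
Qed.

Section Homotopy.
Context {R : realType}.
Implicit Types X Y Z : topologicalType.

Lemma homotopic_sym X Y (f g : X -> Y) : homotopic R f g -> homotopic R g f.
Proof.
move=> /homotopicP[H [cH H0 H1]]; apply/homotopicP.
exists (H \o fun z => (z.1, -1 * z.2 + 1)); split=> [z|x|x] /=.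
- by apply: continuous_comp; [exact: affine_time_continuous|exact: cH].
- by rewrite mulr0 add0r.
- by rewrite mulr1 addNr.
Qed.

(** The concatenation at double speed, glued along the closed halves
    [t <= 1/2] and [1/2 <= t]. *)
Lemma homotopic_trans X Y (g f h : X -> Y) :
  homotopic R f g -> homotopic R g h -> homotopic R f h.
Proof.
move=> /homotopicP[G [cG G0 G1]] /homotopicP[H [cH H0 H1]]; apply/homotopicP.
pose K (z : X * R) : Y := if z.2 <= 2^-1 then G (z.1, 2 * z.2 + 0)
                          else H (z.1, 2 * z.2 + -1).
have KG z : z.2 <= 2^-1 -> K z = G (z.1, 2 * z.2 + 0) by rewrite /K => ->.
have KH z : 2^-1 <= z.2 -> K z = H (z.1, 2 * z.2 + -1).
  rewrite le_eqVlt => /predU1P[z2|z2]; last by rewrite /K leNgt z2.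
  by rewrite /K -z2 lexx mulfV ?pnatr_eq0// addr0 subrr G1 H0.
pose A := snd @^-1` [set t : R | t <= 2^-1] : set (X * R).
pose B := snd @^-1` [set t : R | 2^-1 <= t] : set (X * R).
exists K; split=> [|x|x]; first last.
- rewrite KH /=; last by lra.
  by have -> : 2 * 1 + -1 = 1 :> R by ring.
- rewrite KG /=; last by lra.
  by rewrite mulr0 addr0.
apply/continuous_subspace_setT.
have -> : [set: X * R] = A `|` B.
  apply/seteqP; split=> // z _.
  by case: (leP z.2 2^-1) => z2; [left|right; exact: ltW].
have csnd : continuous (snd : X * R -> R) by move=> z; exact: cvg_snd.
apply: withinU_continuous.
- by apply: preimage_closed => //; exact: closed_le.
- by apply: preimage_closed => //; exact: closed_ge.
- apply: (@subspace_eq_continuous _ _ _ (G \o fun z => (z.1, 2 * z.2 + 0))).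
    by move=> z /set_mem zA; rewrite /= /from_subspace /= KG.
  apply: continuous_subspaceT => z.
  by apply: continuous_comp; [exact: affine_time_continuous|exact: cG].
- apply: (@subspace_eq_continuous _ _ _ (H \o fun z => (z.1, 2 * z.2 + -1))).
    by move=> z /set_mem zA; rewrite /= /from_subspace /= KH.
  apply: continuous_subspaceT => z.
  by apply: continuous_comp; [exact: affine_time_continuous|exact: cH].
Qed.

Lemma homotopic_postcomp X Y Z (h : Y -> Z) (f g : X -> Y) :
  continuous h -> homotopic R f g -> homotopic R (h \o f) (h \o g).
Proof.
move=> ch /homotopicP[H [cH H0 H1]]; apply/homotopicP.
exists (h \o H); split=> [z|x|x] /=; rewrite ?H0 ?H1//.
by apply: continuous_comp; [exact: cH|exact: ch].
Qed.

Lemma homotopic_precomp X Y Z (h : X -> Y) (f g : Y -> Z) :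
  continuous h -> homotopic R f g -> homotopic R (f \o h) (g \o h).
Proof.
move=> ch /homotopicP[H [cH H0 H1]]; apply/homotopicP.
exists (H \o fun z => (h z.1, z.2)); split=> [z|x|x] /=; rewrite ?H0 ?H1//.
apply: continuous_comp; last exact: cH.
apply: (@pair_continuous _ _ _ (h \o fst) snd) => {}z; last exact: cvg_snd.
by apply: continuous_comp; [exact: cvg_fst|exact: ch].
Qed.

Lemma homotopy_equivalent_sym X Y :
  homotopy_equivalent R X Y -> homotopy_equivalent R Y X.
Proof. by move=> [f [g [cf cg gf fg]]]; exists g, f. Qed.

Lemma homotopy_equivalent_trans Y X Z :
  homotopy_equivalent R X Y -> homotopy_equivalent R Y Z ->
  homotopy_equivalent R X Z.
Proof.
move=> [f [f' [cf cf' f'f ff']]] [g [g' [cg cg' g'g gg']]].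
exists (g \o f), (f' \o g'); split.
- by move=> x; apply: continuous_comp; [exact: cf|exact: cg].
- by move=> x; apply: continuous_comp; [exact: cg'|exact: cf'].
- apply: homotopic_trans f'f.
  exact: (homotopic_postcomp cf' (homotopic_precomp cf g'g)).
- apply: homotopic_trans gg'.
  exact: (homotopic_postcomp cg (homotopic_precomp cg' ff')).
Qed.

Lemma ho_eq X Y : homotopy_equivalent R X Y -> ho R X = ho R Y.
Proof.
move=> XY; apply/funext => Z; apply/propext; split=> h.
  exact: homotopy_equivalent_trans (homotopy_equivalent_sym XY) h.
exact: homotopy_equivalent_trans XY h.
Qed.

End Homotopy.

Section Wild.
Context {R : realType} {n : nat}.
Implicit Types X Y : topologicalType.

(** * Wild sets under maps with a left homotopy inverse *)

(** A null-homotopy of [f \o u] composed with [g] is one of [g \o f \o u], which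
    is homotopic to [u]; so composing with [f] keeps maps essential. *)
Lemma wild_homo X Y (f : X -> Y) (g : Y -> X) :
  continuous f -> continuous g -> homotopic R (g \o f) id ->
  {homo f : x / wild R n X x >-> wild R n Y x}.
Proof.
move=> cf cg gf x [u [ess ux ucvg]]; exists (fun k => f \o u k); split.
- move=> k; have [cu nu] := ess k; split.
    by move=> z; apply: continuous_comp; [exact: cu|exact: cf].
  move=> [c fuc]; apply: nu; exists (g c).
  apply: (@homotopic_trans _ _ _ (g \o f \o u k)).
    exact: homotopic_sym (homotopic_precomp cu gf).
  exact: (homotopic_postcomp cg fuc).
- by move=> k /=; rewrite ux.
- move=> U /cf/ucvg[K uK]; exists K => k Kk _ [z _ <-].
  by apply: (uK k Kk); exists z.
Qed.

Lemma homotopic_restrict X (A : set X) (h : X -> X) (H : X * R -> X)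
    (r : A -> A) :
  full_homotopy H h id -> (forall t, {homo (fun x => H (x, t)) : x / A x}) ->
  (forall x, set_val (r x) = h (set_val x)) -> homotopic R r id.
Proof.
move=> [cH H0 H1] HA rh; apply/homotopicP.
have HAA (z : A * R) : A (H (set_val z.1, z.2)) by exact/HA/set_valP.
exists (corestrict HAA); split=> [|x|x]; first last.
- by apply: val_inj; rewrite /= H1.
- by apply: val_inj; rewrite /= H0 -rh.
apply: corestrict_continuous => z.
apply: (@continuous_comp _ _ _ (fun z => (set_val z.1, z.2)) H);
  last exact: cH.
apply: (@pair_continuous _ _ _ (set_val \o fst) snd) => {}z;
  last exact: cvg_snd.
by apply: continuous_comp; [exact: cvg_fst|exact: set_val_continuous].
Qed.

Definition restrict X Y (A : set X) (B : set Y) (f : X -> Y)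
    (fAB : {homo f : x / A x >-> B x}) : A -> B :=
  corestrict (fun x : A => fAB _ (set_valP x)).

Lemma restrict_continuous X Y (A : set X) (B : set Y) (f : X -> Y)
    (fAB : {homo f : x / A x >-> B x}) :
  continuous f -> continuous (restrict fAB).
Proof.
move=> cf; apply: corestrict_continuous => x.
by apply: continuous_comp; [exact: set_val_continuous|exact: cf].
Qed.

(** The maps that witness wildness have to be essential in the subspace, so
    the homotopy from [g \o f] to the identity must itself stay in [A]. *)
Lemma wild_sub_homo X Y (A : set X) (B : set Y)
    (f : X -> Y) (g : Y -> X) (H : X * R -> X) :
  continuous f -> continuous g -> full_homotopy H (g \o f) id ->
  {homo f : x / A x >-> B x} -> {homo g : y / B y >-> A y} ->
  (forall t, {homo (fun x => H (x, t)) : x / A x}) ->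
  {homo f : x / wild_sub R n A x >-> wild_sub R n B x}.
Proof.
move=> cf cg HH fAB gBA HA _ [a wa <-]; exists (restrict fAB a) => //.
apply: (@wild_homo _ _ (restrict fAB) (restrict gBA)) wa.
- exact: restrict_continuous.
- exact: restrict_continuous.
- exact: (homotopic_restrict HH HA).
Qed.

(** Running [H] from time [t] to time 1 is a homotopy from [H (-, t)] to the
    identity, so the identity is a left homotopy inverse of [H (-, t)]. *)
Lemma wild_sub_homo_track X (A : set X) (h : X -> X) (H : X * R -> X) :
  full_homotopy H h id -> (forall t, {homo (fun x => H (x, t)) : x / A x}) ->
  forall t, {homo (fun x => H (x, t)) : x / wild_sub R n A x}.
Proof.
move=> [cH H0 H1] HA t.
apply: (@wild_sub_homo _ _ A A _ id
  (H \o fun z => (z.1, (1 - t) * z.2 + t))) => //.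
- move=> x; apply: continuous_comp; last exact: cH.
  by apply: (@pair_continuous _ _ _ id (fun=> t)) => {}x;
    [exact: cvg_id|exact: cvg_cst].
- by move=> x; exact: cvg_id.
- split=> [z|x|x] /=.
  + by apply: continuous_comp; [exact: affine_time_continuous|exact: cH].
  + by rewrite mulr0 add0r.
  + by rewrite mulr1 subrK H1.
- by move=> s x; exact: HA.
Qed.

(** * Restricting a homotopy equivalence to the iterated wild sets *)

(** The induction hypothesis of the transfinite induction.  A mere homotopy
    equivalence between [A] and [B] would not do: at a limit stage there would
    be no way to combine unrelated equivalences of the earlier stages. *)
Definition restricts X Y (f : X -> Y) (g : Y -> X) (H : X * R -> X)
    (K : Y * R -> Y) (A : set X) (B : set Y) :=
  [/\ {homo f : x / A x >-> B x}, {homo g : y / B y >-> A y},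
      forall t, {homo (fun x => H (x, t)) : x / A x}
    & forall t, {homo (fun y => K (y, t)) : y / B y}].

Section Equivalence.
Variables (X Y : topologicalType) (f : X -> Y) (g : Y -> X).
Variables (H : X * R -> X) (K : Y * R -> Y).
Hypotheses (cf : continuous f) (cg : continuous g).
Hypotheses (HH : full_homotopy H (g \o f) id).
Hypotheses (KK : full_homotopy K (f \o g) id).

Lemma restricts_homotopy_equivalent (A : set X) (B : set Y) :
  restricts f g H K A B -> homotopy_equivalent R A B.
Proof.
move=> [fAB gBA HA KB]; exists (restrict fAB), (restrict gBA); split.
- exact: restrict_continuous.
- exact: restrict_continuous.
- exact: (homotopic_restrict HH HA).
- exact: (homotopic_restrict KK KB).
Qed.

Lemma restricts_wild_sub (A : set X) (B : set Y) :
  restricts f g H K A B ->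
  restricts f g H K (wild_sub R n A) (wild_sub R n B).
Proof.
move=> [fAB gBA HA KB]; split.
- exact: (wild_sub_homo cf cg HH).
- exact: (wild_sub_homo cg cf KK).
- exact: (wild_sub_homo_track HH).
- exact: (wild_sub_homo_track KK).
Qed.

(** A limit stage is an intersection, and the four maps being the same at all
    stages, they restrict to the intersection. *)
Lemma restricts_iterated_wild (d : Order.disp_t) (W : orderType d)
    (wo : well_order (<=%O : rel W)) (k : W) :
  restricts f g H K (iterated_wild R n X wo k) (iterated_wild R n Y wo k).
Proof.
elim: (well_order_wf wo k) => {}k _ IH.
have [[j jk]|nsucc] := pselect (exists j, is_successor j k).
  by rewrite !(iterated_wildS _ _ _ _ jk); exact/restricts_wild_sub/IH/jk.1.
(* This covers the least stage too, where the condition is void. *)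
have lim Z x : iterated_wild R n Z wo k x <->
    forall j, (j < k)%O -> iterated_wild R n Z wo j x.
  rewrite iterated_wildE; split=> [[[j [_ [jk _]]]|[_ ]]|] //.
    by case: nsucc; exists j.
  by right.
split=> [x|y|t x|t y] /lim w; apply/lim => j jk; have [fj gj Hj Kj] := IH j jk.
- exact/fj/w.
- exact/gj/w.
- exact/Hj/w.
- exact/Kj/w.
Qed.

End Equivalence.
End Wild.

Theorem corollary3p16 (R : realType) (n : nat) (X Y : topologicalType)
    (hausX : hausdorff_space X) (hausY : hausdorff_space Y)
    (hXY : homotopy_equivalent R X Y)
    (d : Order.disp_t) (W : orderType d) (wo : well_order (<=%O : rel W))
    (k : W) :
  ho R (set_type (iterated_wild R n X wo k)) =
  ho R (set_type (iterated_wild R n Y wo k)).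
Proof.
apply: ho_eq; case: hXY => f [g [cf cg /homotopicP[H HH] /homotopicP[K KK]]].
apply: (restricts_homotopy_equivalent cf cg HH KK).
exact: restricts_iterated_wild.
Qed.
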